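(* Let $r,c\ge1$ be integers. For any choice of $\lambda_1,\dots,\lambda_c\in\mathbb{C}\setminus\{0\}$ with $\lambda_i\ne\lambda_j$ for $i\neq j$, consider the representation $X=(\mathbb{C}^r,\mathbb{C}^c,\mathbb{C},A,B,I,0,A',B',F)$ of the enhanced ADHM quiver (so $W=\mathbb{C}^r$, $V=\mathbb{C}^c$, $V'=\mathbb{C}$, $J=0$), where $$A=B=\mathrm{diag}(\lambda_1,\dots,\lambda_c),\qquad I=\begin{pmatrix}1&0&\cdots&0\\ \vdots&\vdots&\ddots&\vdots\\ 1&0&\cdots&0\end{pmatrix}\in\mathrm{Hom}(\mathbb{C}^r,\mathbb{C}^c),\qquad F=\begin{pmatrix}1\\0\\ \vdots\\0\end{pmatrix},\qquad A'=B'=(\lambda_1).$$ Then: (i) $X$ is stable; (ii) $[X]\in\mathcal{N}(r,c,1)$ is unobstructed, i.e. $H^2(\mathcal{C}(X))=0$.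
   Context: A representation of the enhanced ADHM quiver of numerical type $(r,c,c')$ is a tuple $X=(W,V,V',A,B,I,J,A',B',F)$, where $W,V,V'$ are complex vector spaces of dimensions $r,c,c'$, and $A,B\in\mathrm{End}(V)$, $I\in\mathrm{Hom}(W,V)$, $J\in\mathrm{Hom}(V,W)$, $A',B'\in\mathrm{End}(V')$, $F\in\mathrm{Hom}(V',V)$ satisfy $$[A,B]+IJ=0,\quad AF-FA'=0,\quad BF-FB'=0,\quad JF=0,\quad [A',B']=0.$$ Stability: $X$ is called stable if (S.1) $F$ is injective, and (S.2) there is no subspace $0\subseteq S\subsetneq V$ with $A(S)\subseteq S$, $B(S)\subseteq S$ and $\mathrm{im}(I)\subseteq S$. (This is equivalent to GIT $\Theta$-stability for any parameter $\Theta=(\theta,\theta',\theta_\infty)$ with $c\theta+c'\theta'+r\theta_\infty=0$, $\theta'>0$ and $\theta+\theta'<0$.) $\mathcal{N}(r,c,c')$ is the corresponding GIT moduli space, whose points are the orbits $[X]$ of stable representations under $\mathrm{GL}(V)\times\mathrm{GL}(V')$, acting by $(A,B,A',B',F,I,J)\mapsto(hAh^{-1},hBh^{-1},h'A'h'^{-1},h'B'h'^{-1},hFh'^{-1},hI,Jh^{-1})$. For $c'=1$ (where the equation $[A',B']=0$ is automatic), the deformation complex $\mathcal{C}(X)$ is the complex, in degrees $0,1,2,3$, $$C^0\xrightarrow{d_0}C^1\xrightarrow{d_1}C^2\xrightarrow{d_2}C^3,$$ with - $C^0=\mathrm{End}(V)\oplus\mathrm{End}(V')$, - $C^1=\mathrm{End}(V)^{\oplus2}\oplus\mathrm{Hom}(W,V)\oplus\mathrm{Hom}(V,W)\oplus\mathrm{End}(V')^{\oplus2}\oplus\mathrm{Hom}(V',V)$,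 - $C^2=\mathrm{End}(V)\oplus\mathrm{Hom}(V',V)^{\oplus2}\oplus\mathrm{Hom}(V',W)$, - $C^3=\mathrm{Hom}(V',V)$, and differentials $$d_0(h,h')=\big([h,A],\,[h,B],\,hI,\,-Jh,\,0,\,0,\,hF-Fh'\big),$$ $$d_1(a,b,i,j,a',b',f)=\big([a,B]+[A,b]+Ij+iJ,\ Af+aF-Fa'-fA',\ Bf+bF-Fb'-fB',\ jF+Jf\big),$$ $$d_2(c_1,c_2,c_3,c_4)=c_1F+Bc_2-c_2B'-Ac_3+c_3A'-Ic_4.$$ A point $[X]\in\mathcal{N}(r,c,1)$ is called unobstructed if $H^2(\mathcal{C}(X))=\ker d_2/\mathrm{im}\,d_1=0$. *)

(* Defs.v *)
From HB Require Import structures.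
From mathcomp Require Import all_boot all_order all_algebra.
From mathcomp Require Import generic_quotient ring_quotient.
From mathcomp Require Import classical_sets reals.
From mathcomp Require Import complex ring.

Set Implicit Arguments.
Unset Strict Implicit.
Unset Printing Implicit Defensive.

Import GRing.Theory.
Local Open Scope ring_scope.

(* Coordinates: W = K^r, V = K^c and V' = K^c' are spaces of column vectors, a
   linear map is its matrix and acts on the left, so that Hom(K^m, K^n) is
   'M[K]_(n, m) and composition is *m.  The constructions make sense over any
   field K; the complex numbers are R[i] for R : realType. *)

Definition commmx (K : fieldType) (n : nat) (M N : 'M[K]_n) : 'M[K]_n :=
  M *m N - N *m M.

Record enhanced_adhm (K : fieldType) (r c c' : nat) := EnhancedADHM {
  opA : 'M[K]_c;
  opB : 'M[K]_c;
  opI : 'M[K]_(c, r);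
  opJ : 'M[K]_(r, c);
  opA' : 'M[K]_c';
  opB' : 'M[K]_c';
  opF : 'M[K]_(c, c');
  adhm_relAB : commmx opA opB + opI *m opJ = 0;
  adhm_relAF : opA *m opF - opF *m opA' = 0;
  adhm_relBF : opB *m opF - opF *m opB' = 0;
  adhm_relJF : opJ *m opF = 0;
  adhm_relA'B' : commmx opA' opB' = 0
}.

Section Moduli.
Variables (K : fieldType) (r c c' : nat).
Implicit Types X Y : enhanced_adhm K r c c'.

Definition stable_rep X : Prop :=
  injective (fun v : 'cV[K]_c' => opF X *m v) /\
  ~ exists S : {vspace 'cV[K]_c},
      [/\ S != fullv,
          forall v, v \in S -> opA X *m v \in S,
          forall v, v \in S -> opB X *m v \in S &
          forall w : 'cV[K]_r, opI X *m w \in S].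

Definition orbit_rep X : set (enhanced_adhm K r c c') :=
  [set Y | exists (h : 'M[K]_c) (h' : 'M[K]_c'),
    (h \in unitmx /\ h' \in unitmx) /\
    [/\ opA Y = h *m opA X *m invmx h, opB Y = h *m opB X *m invmx h,
        opA' Y = h' *m opA' X *m invmx h' & opB' Y = h' *m opB' X *m invmx h'] /\
    [/\ opF Y = h *m opF X *m invmx h', opI Y = h *m opI X &
        opJ Y = opJ X *m invmx h]]%classic.

(* The closed points of the moduli space. *)
Definition moduli : set (set (enhanced_adhm K r c c')) :=
  [set orbit_rep X | X in stable_rep]%classic.

End Moduli.

(* ker g / im f as an additive group.  The quotient is taken by the subspace of
   those elements of ker g that lie in im f, so that g \o f = 0 is not needed
   to form it. *)
Definition cohomology (K : fieldType) (U V W : vectType K)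
    (f : 'Hom(U, V)) (g : 'Hom(V, W)) : zmodType :=
  Quotient.quot (linfun (vsval : subvs_of (lker g) -> V) @^-1: limg f)%VS.

Local Ltac mx_linear :=
  rewrite /commmx !(mulmxDl, mulmxDr) -?scalemxAl -?scalemxAr;
  apply/matrixP => ? ?; rewrite !mxE; ring.

Section Deformation.
Variables (K : fieldType) (r c : nat) (X : enhanced_adhm K r c 1).

Local Notation A := (opA X).
Local Notation B := (opB X).
Local Notation I := (opI X).
Local Notation J := (opJ X).
Local Notation A' := (opA' X).
Local Notation B' := (opB' X).
Local Notation F := (opF X).

Definition defC0 : vectType K := ('M[K]_c * 'M[K]_1)%type.
Definition defC1 : vectType K :=
  ('M[K]_c * 'M[K]_c * 'M[K]_(c, r) * 'M[K]_(r, c)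
   * 'M[K]_1 * 'M[K]_1 * 'M[K]_(c, 1))%type.
Definition defC2 : vectType K :=
  ('M[K]_c * 'M[K]_(c, 1) * 'M[K]_(c, 1) * 'M[K]_(r, 1))%type.
Definition defC3 : vectType K := 'M[K]_(c, 1).

Definition def_d0 (x : defC0) : defC1 :=
  let: (h, h') := x in
  (commmx h A, commmx h B, h *m I, - (J *m h), 0, 0, h *m F - F *m h').

Definition def_d1 (x : defC1) : defC2 :=
  let: (a, b, i, j, a', b', f) := x in
  (commmx a B + commmx A b + I *m j + i *m J,
   A *m f + a *m F - F *m a' - f *m A',
   B *m f + b *m F - F *m b' - f *m B',
   j *m F + J *m f).

Definition def_d2 (x : defC2) : defC3 :=
  let: (c1, c2, c3, c4) := x in
  c1 *m F + B *m c2 - c2 *m B' - A *m c3 + c3 *m A' - I *m c4.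

Let dist := (mulmxDl, mulmxDr, mulmxBl, mulmxBr, mulNmx, mulmxN, mulmxA).

Lemma def_d0_linear : linear def_d0.
Proof.
move=> k [h h'] [g g'].
have e1 (M : 'M[K]_c) :
    commmx (k *: h + g) M = k *: commmx h M + commmx g M by mx_linear.
have e2 : (k *: h + g) *m I = k *: (h *m I) + g *m I by mx_linear.
have e3 : - (J *m (k *: h + g)) = k *: - (J *m h) - J *m g by mx_linear.
have e4 : (k *: h + g) *m F - F *m (k *: h' + g')
    = k *: (h *m F - F *m h') + (g *m F - F *m g') by mx_linear.
have e5 : 0 = k *: 0 + 0 :> 'M[K]_1 by rewrite scaler0 addr0.
by rewrite /def_d0 /= e1 e1 e2 e3 e4 {1 2}e5.
Qed.

Lemma def_d1_linear : linear def_d1.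
Proof.
move=> k [[[[[[a b] i] j] a'] b'] f] [[[[[[u v] s] t] u'] v'] g].
have e1 : commmx (k *: a + u) B + commmx A (k *: b + v)
      + I *m (k *: j + t) + (k *: i + s) *m J
    = k *: (commmx a B + commmx A b + I *m j + i *m J)
      + (commmx u B + commmx A v + I *m t + s *m J) by mx_linear.
have e2 (M : 'M[K]_c) (M' : 'M[K]_1) x y x' y' :
    M *m (k *: f + g) + (k *: x + y) *m F - F *m (k *: x' + y')
      - (k *: f + g) *m M'
    = k *: (M *m f + x *m F - F *m x' - f *m M')
      + (M *m g + y *m F - F *m y' - g *m M') by mx_linear.
have e3 : (k *: j + t) *m F + J *m (k *: f + g)
    = k *: (j *m F + J *m f) + (t *m F + J *m g) by mx_linear.
by rewrite /def_d1 /= e1 !e2 e3.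
Qed.

Lemma def_d2_linear : linear def_d2.
Proof.
move=> k [[[c1 c2] c3] c4] [[[e1 e2] e3] e4]; rewrite /def_d2 /=.
by mx_linear.
Qed.

HB.instance Definition _ :=
  GRing.isLinear.Build K defC0 defC1 _ def_d0 def_d0_linear.
HB.instance Definition _ :=
  GRing.isLinear.Build K defC1 defC2 _ def_d1 def_d1_linear.
HB.instance Definition _ :=
  GRing.isLinear.Build K defC2 defC3 _ def_d2 def_d2_linear.

Let AF : A *m F = F *m A'.
Proof. exact/subr0_eq/adhm_relAF. Qed.

Let BF : B *m F = F *m B'.
Proof. exact/subr0_eq/adhm_relBF. Qed.

Let comm1 (M N : 'M[K]_1) : M *m N = N *m M.
Proof. by rewrite [M]mx11_scalar scalar_mxC. Qed.

Lemma def_d1_d0 (x : defC0) : def_d1 (def_d0 x) = 0.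
Proof.
have AB : I *m J = B *m A - A *m B.
  by apply/eqP; rewrite -subr_eq0 opprB addrC adhm_relAB.
case: x => h h'; rewrite /def_d1 /def_d0 /commmx.
rewrite !mulmx0 ?subr0.
congr (_, _, _, _); rewrite ?dist.
- rewrite -!(mulmxA h) AB !dist.
  apply/matrixP => p q; rewrite !mxE; ring.
- rewrite -!mulmxA (comm1 h') !mulmxA AF -(mulmxA h F) -AF !mulmxA.
  apply/matrixP => p q; rewrite !mxE; ring.
- rewrite -!mulmxA (comm1 h') !mulmxA BF -(mulmxA h F) -BF !mulmxA.
  apply/matrixP => p q; rewrite !mxE; ring.
- rewrite adhm_relJF mul0mx subr0; exact: addNr.
Qed.

Lemma def_d2_d1 (x : defC1) : def_d2 (def_d1 x) = 0.
Proof.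
have AB : I *m J = B *m A - A *m B.
  by apply/eqP; rewrite -subr_eq0 opprB addrC adhm_relAB.
case: x => [[[[[[a b] i] j] a'] b'] f]; rewrite /def_d2 /def_d1 /commmx.
rewrite ?dist AB ?dist.
have -> : i *m J *m F = 0 by rewrite -mulmxA adhm_relJF mulmx0.
have -> : a *m B *m F = a *m F *m B' by rewrite -!mulmxA BF.
have -> : b *m A *m F = b *m F *m A' by rewrite -!mulmxA AF.
have -> : f *m A' *m B' = f *m B' *m A' by rewrite -!mulmxA (comm1 A').
rewrite AF BF -!(mulmxA F) (comm1 a') (comm1 b') !mulmxA.
apply/matrixP => p q; rewrite !mxE; ring.
Qed.

Definition H2 : zmodType := cohomology (linfun def_d1) (linfun def_d2).

(* A property of the representation X; H2 only depends, up to isomorphism, on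
   its orbit. *)
Definition unobstructed : Prop := forall x : H2, x = 0.

End Deformation.

Section DiagonalPoint.
Variables (K : fieldType) (r c : nat) (c_gt0 : (0 < c)%N) (lambda : 'I_c -> K).

Let i0 : 'I_c := Ordinal c_gt0.

Definition diagA : 'M[K]_c := diag_mx (\row_i lambda i).
Definition diagI : 'M[K]_(c, r) := \matrix_(i < c, j < r) (j == 0 :> nat)%:R.
Definition diagF : 'M[K]_(c, 1) := \matrix_(i < c, j < 1) (i == 0 :> nat)%:R.
Definition diagA' : 'M[K]_1 := (lambda i0)%:M.

Lemma diag_relAB : commmx diagA diagA + diagI *m (0 : 'M[K]_(r, c)) = 0.
Proof. by rewrite /commmx subrr mulmx0 addr0. Qed.

Lemma diag_relAF : diagA *m diagF - diagF *m diagA' = 0.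
Proof.
rewrite /diagA' mul_mx_scalar mul_diag_mx; apply/matrixP => i j; rewrite !mxE.
have [e|_] := eqVneq (i : nat) 0; last by rewrite !mulr0 subrr.
by have -> : i = i0; [exact: val_inj | rewrite subrr].
Qed.

Lemma diag_relJF : (0 : 'M[K]_(r, c)) *m diagF = 0.
Proof. exact: mul0mx. Qed.

Lemma diag_relA'B' : commmx diagA' diagA' = 0.
Proof. exact: subrr. Qed.

Definition diag_point : enhanced_adhm K r c 1 :=
  EnhancedADHM diag_relAB diag_relAF diag_relAF diag_relJF diag_relA'B'.

End DiagonalPoint.

(* Main.v *)
Require Import Defs.
From mathcomp Require Import all_boot all_order all_algebra.
From mathcomp Require Import generic_quotient ring_quotient.
From mathcomp Require Import classical_sets reals complex ring.
Import GRing.Theory.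
Local Open Scope ring_scope.

(** The argument works over any field.  Let D be the diagonal matrix of the
    [lambda i], which are pairwise distinct, and 0 the first index.

    Stability.  The map F is the first coordinate line, hence injective.  A
    subspace that contains the image of I contains the all-ones vector, which
    is a cyclic vector for D because the [lambda i] are distinct: applying the
    Lagrange product of the (D - lambda k), for k != i, to it gives a nonzero
    multiple of the i-th basis vector ([cyclic_subspace_full]).

    Unobstructedness.  H^2 vanishes as soon as ker d2 is contained in im d1
    ([cohomology_eq0]).  Since A = B = D and J = 0, a preimage of a cocycle
    (c1, c2, c3, c4) can be sought with i = a' = b' = f = 0.  Writing g = b - a,
    the equations become
      [D, g] + I j = c1,   a F = c2,   g F = c3 - c2,   j F = c4.
    The entry (p, q) of the first one reads
    (lambda p - lambda q) g_pq + j_0q = c1_pq.  The last three equations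
    prescribe the first columns of a, g and j, and with these values the first
    column of the first equation is exactly the cocycle condition.  In any
    other column q the diagonal entry forces j_0q = c1_qq, and the off-diagonal
    entries then determine g_pq, by division by lambda p - lambda q
    ([diag_point_ker_sub_im]). *)

Lemma cohomology_eq0 (K : fieldType) (U V W : vectType K)
    (f : 'Hom(U, V)) (g : 'Hom(V, W)) :
  (lker g <= limg f)%VS -> forall x : cohomology f g, x = 0.
Proof.
rewrite /cohomology => ker_sub x; apply/eqP.
rewrite -[x]reprK piE Quotient.equivE subr0.
rewrite -memv_preim lfunE; apply: (subvP ker_sub); exact: subvsP.
Qed.

Section DiagonalPointProperties.

Variables (K : fieldType) (r c : nat) (r_gt0 : (0 < r)%N) (c_gt0 : (0 < c)%N).
Variable lambda : 'I_c -> K.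
Hypothesis lambda_neq : forall i j : 'I_c, i != j -> lambda i != lambda j.

Let i0 : 'I_c := Ordinal c_gt0.
Let j0 : 'I_r := Ordinal r_gt0.
Local Notation D := (diagA lambda).

Lemma mul_diagF (m : nat) (M : 'M[K]_(m, c)) : M *m diagF K c = col i0 M.
Proof.
apply/matrixP => p q; rewrite !mxE (bigD1 i0) //= !mxE eqxx mulr1.
rewrite big1 ?addr0 // => k neq_k; rewrite !mxE.
have /negPf -> : (k : nat) != 0.
  by apply: contraNneq neq_k => k_0; apply/eqP/val_inj.
by rewrite mulr0.
Qed.

Lemma mul_diagI (n : nat) (M : 'M[K]_(r, n)) :
  diagI K r c *m M = \matrix_(p, q) M j0 q.
Proof.
apply/matrixP => p q; rewrite !mxE (bigD1 j0) //= !mxE eqxx mul1r.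
rewrite big1 ?addr0 // => k neq_k; rewrite !mxE.
have /negPf -> : (k : nat) != 0.
  by apply: contraNneq neq_k => k_0; apply/eqP/val_inj.
by rewrite mul0r.
Qed.

Lemma commmx_diagA (M : 'M[K]_c) p q :
  commmx D M p q = (lambda p - lambda q) * M p q.
Proof. rewrite /commmx mul_diag_mx mul_mx_diag !mxE; ring. Qed.

Lemma diagF_inj : injective (fun v : 'cV[K]_1 => diagF K c *m v).
Proof.
move=> u v /matrixP /(_ i0 0); rewrite !mxE !big_ord1 !mxE eqxx !mul1r => uv.
by apply/matrixP => p q; rewrite !ord1.
Qed.

(** The all-ones vector is cyclic for D: each factor D - lambda k maps the
    subspace to itself, and the product of these factors over all k != i kills
    every coordinate of that vector but the i-th. *)
Lemma cyclic_subspace_full (S : {vspace 'cV[K]_c}) :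
  (forall v, v \in S -> D *m v \in S) -> const_mx 1 \in S -> S = fullv.
Proof.
move=> S_stable S1.
have S_prod (s : seq 'I_c) : \col_i \prod_(k <- s) (lambda i - lambda k) \in S.
  elim: s => [|k s IHs].
    by congr (_ \in S): S1; apply/matrixP => p q; rewrite !mxE big_nil.
  have := memvB (S_stable _ IHs) (memvZ (lambda k) IHs).
  congr (_ \in S); apply/matrixP => p q.
  by rewrite mul_diag_mx !mxE big_cons mulrBl.
have S_delta i : (delta_mx i 0 : 'cV_c) \in S.
  set d := \prod_(k | k != i) (lambda i - lambda k).
  have d_neq0 : d != 0.
    by apply/prodf_neq0 => k ki; rewrite subr_eq0 lambda_neq // eq_sym.
  have := memvZ d^-1 (S_prod [seq k <- index_enum 'I_c | k != i]).
  congr (_ \in S); apply/matrixP => p q; rewrite !mxE ord1 eqxx andbT big_filter.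
  have [->|neq_pi] := eqVneq p i; first by rewrite mulVf.
  by rewrite (bigD1 p) //= subrr mul0r mulr0.
apply/vspaceP => v; rewrite memvf; rewrite (matrix_sum_delta v).
by apply: memv_suml => i _; apply: memv_suml => j _; rewrite ord1 memvZ.
Qed.

Lemma diag_point_stable : stable_rep (diag_point r c_gt0 lambda).
Proof.
split; first exact: diagF_inj.
case=> S [/eqP S_proper S_A _ S_I]; apply: S_proper.
apply: cyclic_subspace_full S_A _.
have := S_I (delta_mx j0 0); congr (_ \in S).
by rewrite mul_diagI; apply/matrixP => p q; rewrite !mxE ord1 !eqxx.
Qed.

(** A preimage with i = a' = b' = f = 0 exists: once the first columns of a,
    g = b - a and j are prescribed, the cocycle condition settles the first
    column of [D, g] + I j = c1, and the other columns are solved entrywise. *)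
Lemma diag_point_ker_sub_im (x : defC2 K r c) :
  def_d2 (diag_point r c_gt0 lambda) x = 0 ->
  exists y, def_d1 (diag_point r c_gt0 lambda) y = x.
Proof.
case: x => [[[c1 c2] c3] c4] cocycle.
(* The cocycle condition is the first column of [D, g] + I j = c1, once the
   first columns of g and j are c3 - c2 and c4. *)
have c1_col0 p : (lambda p - lambda i0) * (c3 p 0 - c2 p 0) + c4 j0 0 = c1 p i0.
  move/matrixP/(_ p 0): cocycle; rewrite /def_d2 /= mul_diagF /diagA'.
  rewrite mul_diagI !mul_mx_scalar !mul_diag_mx !mxE.
  move=> /eqP; rewrite subr_eq0 => /eqP <-; ring.
pose j : 'M[K]_(r, c) :=
  \matrix_(s, q) if q == i0 then c4 s 0 else c1 q q.
(* For p = q the quotient is 0 / 0 = 0; the value does not matter there, since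
   D commutes with diagonal matrices and j alone gives the entry c1_qq. *)
pose g : 'M[K]_c := \matrix_(p, q)
  if q == i0 then c3 p 0 - c2 p 0
  else (c1 p q - c1 q q) / (lambda p - lambda q).
pose a : 'M[K]_c := \matrix_(p, q) c2 p 0.
exists (a, a + g, 0, j, 0, 0, 0).
have bracket : commmx a D + commmx D (a + g) = commmx D g.
  rewrite /commmx mulmxDr mulmxDl; apply/matrixP => p q; rewrite !mxE; ring.
rewrite /def_d1 /= bracket !(mulmx0, mul0mx) !(addr0, add0r, subr0).
rewrite !mul_diagF mul_diagI.
congr (_, _, _, _); apply/matrixP => p q; last 3 first.
- by rewrite !mxE ord1.
- by rewrite !mxE eqxx ord1 addrC subrK.
- by rewrite !mxE eqxx ord1.
rewrite [LHS]mxE commmx_diagA !mxE.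
have [->|_] := eqVneq q i0; first exact: c1_col0.
have [->|neq_pq] := eqVneq p q; first by rewrite subrr mul0r add0r.
by rewrite mulrC divfK ?subrK // subr_eq0 lambda_neq.
Qed.

Lemma diag_point_unobstructed : unobstructed (diag_point r c_gt0 lambda).
Proof.
apply: cohomology_eq0; apply/subvP => x.
rewrite memv_ker lfunE => /eqP /diag_point_ker_sub_im [y <-].
by rewrite -[def_d1 _ y]lfunE memv_img ?memvf.
Qed.

End DiagonalPointProperties.

Theorem proposition10 (R : realType) (r c : nat)
    (r_gt0 : (0 < r)%N) (c_gt0 : (0 < c)%N)
    (lambda : 'I_c -> R[i])
    (lambda_neq0 : forall i, lambda i != 0)
    (lambda_neq : forall i j : 'I_c, i != j -> lambda i != lambda j) :
  let X := diag_point r c_gt0 lambda in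
  stable_rep X /\ (moduli (orbit_rep X) /\ unobstructed X).
Proof.
move=> X; have X_stable : stable_rep X by exact: diag_point_stable.
split=> //; split; first by exists X.
exact: diag_point_unobstructed.
Qed.
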